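(* Let $a$ be a weak composition of length $n$. Then \[\mathcal{A}_a=\sum_{S\in\mathrm{HSSF}(a)}\mathfrak{L}_{\mathrm{wt}(S)}.\]
   Context: $D(a)$: $a_i$ left-justified boxes in row $i$, row 1 lowest, columns numbered from the left. For a filling $S$, $\mathrm{wt}(S)$ is the weak composition of length $n$ whose $i$th part is the number of entries $i$. Triples (rows $r<s$): Type A: $\gamma=(r,c),\alpha=(r,c+1),\beta=(s,c+1)$ with $a_r\ge a_s$; Type B: $\gamma=(s,c),\alpha=(s,c+1),\beta=(r,c)$ with $a_s>a_r$; inversion triple: $\beta>\gamma\ge\alpha$ or $\gamma\ge\alpha>\beta$. $\mathcal{A}\mathrm{SSF}(a)$ is the set of fillings of $D(a)$ with positive integers, rows weakly decreasing left to right, distinct entries in each column, all triples inversion triples, and first-column entry of each nonempty row $i$ equal to $i$; $\mathcal{A}_a=\sum_{S\in\mathcal{A}\mathrm{SSF}(a)}x^{\mathrm{wt}(S)}$. $S\in\mathcal{A}\mathrm{SSF}(a)$ is particle-highest if for every entry value $i$ appearing in $S$, either the leftmost occurrence of $i$ is in the first column, or some occurrence of $i^\uparrow$ lies in a column weakly right of the leftmost $i$, where $i^\uparrow$ is the smallest entry of $S$ larger than $i$. $\mathrm{HSSF}(a)$ is the set of particle-highest elements of $\mathcal{A}\mathrm{SSF}(a)$. Fixed slides: a local move replaces consecutive entries $(0,k)$ at positions $p,p+1$ of a weak composition by $(i,j)$ with $i+j=k$, $i,j\ge0$; a fixed slide of $b$ is obtained from $b$ by a (possibly empty) sequence of such moves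 where $j>0$ is required whenever $b_{p+1}\neq 0$. $\mathfrak{L}_b=\sum x^{c}$ over the set of fixed slides $c$ of $b$. *)

(* Defs.v *)
From HB Require Import structures.
From mathcomp Require Import all_boot all_order all_algebra.
From mathcomp Require Import mpoly.
From Stdlib Require Import ClassicalEpsilon.

Set Implicit Arguments.
Unset Strict Implicit.
Unset Printing Implicit Defensive.

Import GRing.Theory.
Local Open Scope ring_scope.

(* Weak compositions are [seq nat]; a weak composition of length n is  *)
(* a [seq nat] of size n.  Rows and columns are numbered from 1.       *)

Definition arow (a : seq nat) (r : nat) : nat := nth 0%N a r.-1.

Definition in_diag (a : seq nat) (r c : nat) : bool :=
  [&& (1 <= r)%N, (r <= size a)%N, (1 <= c)%N & (c <= arow a r)%N].

Definition cells (a : seq nat) : seq (nat * nat) :=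
  [seq (r, c) | r <- iota 1 (size a), c <- iota 1 (arow a r)].

(* A filling of D(a) is a [seq (seq nat)] of shape a: row r is the list
   [nth [::] S r.-1] read from left to right, of length a_r.             *)
Definition ent (S : seq (seq nat)) (r c : nat) : nat :=
  nth 0%N (nth [::] S r.-1) c.-1.

Definition inv_triple (beta gamma alpha : nat) : bool :=
  ((gamma < beta) && (alpha <= gamma))%N || ((alpha <= gamma) && (beta < alpha))%N.

Definition typeA_ok (a : seq nat) (S : seq (seq nat)) : bool :=
  all (fun p => let: (r, c) := p in
        all (fun s =>
          [&& (r < s)%N, (arow a s <= arow a r)%N, in_diag a r c.+1 & in_diag a s c.+1]
          ==> inv_triple (ent S s c.+1) (ent S r c) (ent S r c.+1))
        (iota 1 (size a)))
      (cells a).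

Definition typeB_ok (a : seq nat) (S : seq (seq nat)) : bool :=
  all (fun p => let: (s, c) := p in
        all (fun r =>
          [&& (r < s)%N, (arow a r < arow a s)%N, in_diag a s c.+1 & in_diag a r c]
          ==> inv_triple (ent S r c) (ent S s c) (ent S s c.+1))
        (iota 1 (size a)))
      (cells a).

Definition assf (a : seq nat) (S : seq (seq nat)) : bool :=
  [&& map size S == a,
      all (fun p => 0 < ent S p.1 p.2)%N (cells a),
      all (fun p => (p.2.+1 <= arow a p.1)%N ==> (ent S p.1 p.2.+1 <= ent S p.1 p.2)%N)
          (cells a),
      all (fun p => all (fun q => ((p.1 < q.1)%N && (p.2 == q.2)) ==>
                                  (ent S p.1 p.2 != ent S q.1 q.2)) (cells a)) (cells a),
      typeA_ok a S,
      typeB_ok a S &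
      all (fun i => (0 < arow a i)%N ==> (ent S i 1 == i)) (iota 1 (size a))].

Definition particle_highest (a : seq nat) (S : seq (seq nat)) : bool :=
  all (fun p0 =>
    let i := ent S p0.1 p0.2 in
    has (fun p =>
      [&& ent S p.1 p.2 == i,
          all (fun q => (ent S q.1 q.2 == i) ==> (p.2 <= q.2)%N) (cells a) &
          (p.2 == 1%N) ||
          has (fun q =>
            [&& (i < ent S q.1 q.2)%N,
                all (fun q' => (i < ent S q'.1 q'.2)%N ==> (ent S q.1 q.2 <= ent S q'.1 q'.2)%N)
                    (cells a) &
                (p.2 <= q.2)%N]) (cells a)]) (cells a))
    (cells a).

Definition hssf (a : seq nat) (S : seq (seq nat)) : bool :=
  assf a S && particle_highest a S.

Definition wt (n : nat) (S : seq (seq nat)) : seq nat :=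
  [seq count_mem i (flatten S) | i <- iota 1 n].

Fixpoint words (k m : nat) : seq (seq nat) :=
  match k with
  | 0 => [:: [::]]
  | k'.+1 => [seq x :: w | x <- iota 1 m, w <- words k' m]
  end.

(* all fillings of D(a) with entries in {1, ..., m} (no repetition).
   Elements of ASSF(a) have entries <= n = size a (row i starts with i and
   rows weakly decrease), so [fillings a (size a)] contains all of ASSF(a). *)
Fixpoint fillings (a : seq nat) (m : nat) : seq (seq (seq nat)) :=
  match a with
  | [::] => [:: [::]]
  | len :: a' => [seq w :: T | w <- words len m, T <- fillings a' m]
  end.

Definition mono (n : nat) (c : seq nat) : 'X_{1..n} :=
  [multinom nth 0%N c i | i < n].

Definition Apoly (n : nat) (a : seq nat) : {mpoly int[n]} :=
  \sum_(F <- fillings a (size a) | assf a F) 'X_[mono n (wt n F)].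

Definition local_move (b d d' : seq nat) : Prop :=
  exists p i j : nat,
    [/\ (1 <= p)%N && (p.+1 <= size d)%N,
        nth 0%N d p.-1 = 0%N,
        (i + j)%N = nth 0%N d p,
        (nth 0%N b p != 0%N -> (0 < j)%N) &
        d' = set_nth 0%N (set_nth 0%N d p.-1 i) p j].

Inductive fixed_slide (b : seq nat) : seq nat -> Prop :=
  | fs_refl : fixed_slide b b
  | fs_step : forall d d', fixed_slide b d -> local_move b d d' -> fixed_slide b d'.

(* all weak compositions of length n and size s (no repetition); moves
   preserve length and size, so these contain all fixed slides of b. *)
Fixpoint wcomps (n s : nat) : seq (seq nat) :=
  match n with
  | 0 => if s is 0 then [:: [::]] else [::]
  | n'.+1 => [seq k :: w | k <- iota 0 s.+1, w <- wcomps n' (s - k)]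
  end.

Definition pdec (P : Prop) : bool :=
  if excluded_middle_informative P then true else false.

Definition Lpoly (n : nat) (b : seq nat) : {mpoly int[n]} :=
  \sum_(c <- wcomps n (sumn b) | pdec (fixed_slide b c)) 'X_[mono n c].

(* Main.v *)
(* In a filling T of A-SSF(a) merge every value i violating the particle-highest
   condition with the next larger value, repeatedly; the result S is obtained by
   raising each value to the least value above it that satisfies the condition.
   A merged value lies strictly to the right of the value it is merged with, so
   S and T have the same standardization, where equal entries are ordered from
   right to left.  All conditions defining A-SSF(a), once the first column is
   fixed, compare an entry with an entry weakly to its right, hence depend only
   on the standardization.  Conversely, a filling is determined by its weight and
   its standardization, and splitting the values of a particle-highest S, the
   rightmost occurrences becoming the smallest, realizes exactly the fixed slides
   of wt(S). *)
Require Import Defs.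
From HB Require Import structures.
From mathcomp Require Import all_boot all_order all_algebra.
From mathcomp Require Import mpoly.
From mathcomp Require Import zify.

Set Implicit Arguments.
Unset Strict Implicit.
Unset Printing Implicit Defensive.

Import GRing.Theory.

Local Open Scope nat_scope.

(** * Minimisation and counting over finite lists *)

Lemma seq_argmin (U : eqType) (X : seq U) (P : pred U) (key : U -> nat) :
  has P X ->
  exists x, [/\ x \in X, P x & {in X, forall y, P y -> key x <= key y}].
Proof.
move=> /hasP[x0 x0X Px0].
have ex : exists k, has (fun x => P x && (key x == k)) X.
  by exists (key x0); apply/hasP; exists x0; rewrite ?Px0 ?eqxx.
case: (ex_minnP ex) => k /hasP[x xX /andP[Px /eqP kx]] kmin.
exists x; split=> // y yX Py; rewrite kx; apply: kmin.
by apply/hasP; exists y; rewrite ?Py ?eqxx.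
Qed.

Lemma count_le1 (U : eqType) (X : seq U) (P : pred U) :
  uniq X -> {in X &, forall x y, P x -> P y -> x = y} -> count P X <= 1.
Proof.
move=> uX inj; rewrite -size_filter.
case E : [seq x <- X | P x] => [|x [|y s]] //.
have uf : uniq [seq x <- X | P x] by rewrite filter_uniq.
have : x \in [seq x <- X | P x] by rewrite E inE eqxx.
have : y \in [seq x <- X | P x] by rewrite E !inE eqxx orbT.
rewrite !mem_filter => /andP[Py yX] /andP[Px xX].
by move: uf; rewrite E (inj x y) //= inE eqxx.
Qed.

(** Moving the threshold one column to the left adds at most one cell, since [P] holds at most once
    per column; so the count passes through every value up to [count P X]. This serves to select the
    rightmost [i] cells of a given value. *)
Lemma column_threshold (X : seq (nat * nat)) (P : pred (nat * nat)) i :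
  uniq X -> {in X &, forall x y, P x -> P y -> x.2 = y.2 -> x = y} ->
  i <= count P X -> exists t, count (fun x => P x && (t <= x.2)) X = i.
Proof.
move=> uX inj iP; pose h t := count (fun x => P x && (t <= x.2)) X.
have ex : exists t, h t <= i.
  exists (\max_(x <- X) x.2).+1; rewrite /h (eq_in_count (a2 := pred0)) ?count_pred0 //.
  move=> x xX /=; have := @leq_bigmax_seq _ X (fun _ => true) (fun x => x.2) x xX isT.
  by case: (P x) => //=; lia.
case: (ex_minnP ex) => t ht tmin; exists t; apply/eqP; rewrite eqn_leq ht /=.
case: t ht tmin => [|t] ht tmin.
  by apply: leq_trans iP _; rewrite leq_eqVlt; apply/orP; left; apply/eqP;
    apply: eq_count => x /=; rewrite andbT.
have : i < h t by rewrite ltnNge; apply/negP => /tmin; rewrite ltnn.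
suff : h t <= h t.+1 + 1 by rewrite -/(h t.+1); lia.
have -> : h t = h t.+1 + count (fun x => P x && (x.2 == t)) X.
  rewrite /h -count_predUI -[LHS]addn0; congr (_ + _).
    by apply: eq_count => x /=; case: (P x) => //=; lia.
  rewrite -[LHS](count_pred0 X); apply: eq_count => x /=.
  by case: (P x) => //=; lia.
rewrite leq_add2l; apply: count_le1 => // x y xX yX /andP[Px /eqP x2] /andP[Py /eqP y2].
by apply: inj; rewrite ?x2.
Qed.

(** * Standardization, merging and the particle-highest condition on a list of cells *)

Section Merging.

Variable X : seq (nat * nat).
Implicit Types f g S T : nat * nat -> nat.

(* [f] and [g] have the same standardization: cells are compared first by
   value, then from right to left. *)
Definition same_std f g :=
  {in X &, forall x y, x.2 <= y.2 -> (f y <= f x) = (g y <= g x)}.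

(* [S] is obtained from [T] by raising the values in each of some disjoint
   intervals to the largest one, without changing the standardization. *)
Definition merges S T :=
  [/\ same_std T S,
      {in X &, forall x y, (T x <= S y) = (S x <= S y)} &
      {in X, forall y, exists2 x, x \in X & T x = S y}].

(** The condition is isolated for a single value, in the same form as the body of
    [particle_highest], so that the two agree by conversion. *)
Definition highest_at f (v : nat) : bool :=
  has (fun p =>
    [&& f p == v,
        all (fun q => (f q == v) ==> (p.2 <= q.2)) X &
        (p.2 == 1) ||
        has (fun q =>
          [&& v < f q,
              all (fun q' => (v < f q') ==> (f q <= f q')) X &
              p.2 <= q.2]) X]) X.

Lemma highest_atP f v :
  reflect (exists p, [/\ p \in X, f p = v,
             {in X, forall q, f q = v -> p.2 <= q.2} &
             p.2 = 1 \/ exists q, [/\ q \in X, v < f q,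
               {in X, forall q', v < f q' -> f q <= f q'} & p.2 <= q.2]])
          (highest_at f v).
Proof.
apply: (iffP hasP) => [[p pX /and3P[/eqP fp /allP lm H]]|[p [pX fp lm H]]].
  exists p; split=> // [q qX /eqP fq|]; first exact: (implyP (lm q qX)).
  case/orP: H => [/eqP|/hasP[q qX /and3P[vq /allP qmin pq]]]; first by left.
  by right; exists q; split=> // q' q'X; apply/implyP/qmin.
exists p => //; rewrite fp eqxx /=; apply/andP; split.
  by apply/allP => q qX; apply/implyP => /eqP; apply: lm.
case: H => [->//|[q [qX vq qmin pq]]].
apply/orP; right; apply/hasP; exists q => //; rewrite vq pq andbT /=.
by apply/allP => q' q'X; apply/implyP/qmin.
Qed.

Lemma same_std_trans f g h : same_std f g -> same_std g h -> same_std f h.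
Proof. by move=> fg gh x y xX yX xy; rewrite fg // gh. Qed.

Lemma same_std_sym f g : same_std f g -> same_std g f.
Proof. by move=> fg x y xX yX xy; rewrite fg. Qed.

Lemma same_std_lt f g x y : same_std f g -> x \in X -> y \in X ->
  g y < g x -> f y <= f x.
Proof.
move=> fg xX yX lt; case: (leqP x.2 y.2) => [xy|/ltnW yx].
  by rewrite fg // ltnW.
by rewrite ltnW // ltnNge fg // -ltnNge.
Qed.

(** If [f x < g x], the common standardization puts the cells with [g] at most [f x] among those
    with [f] at most [f x]. Equal counts make the two sets coincide, yet [x] lies only in the
    second. *)
Lemma same_std_count_eq f g : same_std f g ->
  (forall v, count (fun x => f x <= v) X = count (fun x => g x <= v) X) ->
  {in X, f =1 g}.
Proof.
have main f1 g1 : same_std f1 g1 ->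
    (forall v, count (fun x => f1 x <= v) X = count (fun x => g1 x <= v) X) ->
    {in X, forall x, g1 x <= f1 x}.
  move=> fg cnt x xX; rewrite leqNgt; apply/negP => lt.
  have : count (fun y => (f1 y <= f1 x) && ~~ (g1 y <= f1 x)) X = 0.
    have := count_predC (fun y => g1 y <= f1 x) [seq y <- X | f1 y <= f1 x].
    rewrite !count_filter size_filter cnt.
    rewrite (eq_in_count (a2 := fun y => g1 y <= f1 x)).
      by move=> /eqP; rewrite -[X in _ == X]addn0 eqn_add2l => /eqP <-;
        apply: eq_count => y /=; rewrite andbC.
    move=> y yX /=; case: leqP => //= gy.
    by rewrite (same_std_lt fg) // (leq_ltn_trans gy).
  apply/eqP; rewrite -lt0n -has_count; apply/hasP; exists x => //.
  by rewrite leqnn -ltnNge.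
move=> fg cnt x xX; apply/eqP; rewrite eqn_leq.
by rewrite (main f g) // (main g f) //; exact: same_std_sym.
Qed.

Lemma merges_refl S : merges S S.
Proof. by split=> // y yX; exists y. Qed.

Lemma merges_le S T : merges S T -> {in X, forall x, T x <= S x}.
Proof. by move=> [_ le _] x xX; rewrite le. Qed.

(** A cell where [T] takes the value [S x] is weakly right of column one, so the standardization
    bounds this value by [T x]. *)
Lemma merges_col1 S T : {in X, forall x, 1 <= x.2} -> merges S T ->
  {in X, forall x, x.2 = 1 -> T x = S x}.
Proof.
move=> col_gt0 ST x xX x1; have [std le val] := ST.
have [y yX Ty] := val x xX; apply/eqP; rewrite eqn_leq (merges_le ST) //=.
by rewrite -Ty std ?x1 ?col_gt0 // -le // Ty.
Qed.

Lemma merges_val S T x y : merges S T -> x \in X -> y \in X ->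
  T x = S y -> S x = S y.
Proof.
move=> ST xX yX E; have [_ le _] := ST; apply/eqP; rewrite eqn_leq.
by rewrite -le // E leqnn -E (merges_le ST).
Qed.

(** The leftmost cell where [S] has the value [S y] keeps that value in [T]. The cells with larger
    values are the same for both, and the next larger value of [T] is merged into the next larger
    value of [S]. *)
Lemma merges_highest_at S T y : merges S T -> y \in X ->
  highest_at T (S y) = highest_at S (S y).
Proof.
move=> ST yX; have [std le val] := ST.
have val_le := merges_le ST.
have gt x : x \in X -> (S y < T x) = (S y < S x) by move=> xX; rewrite !ltnNge le.
apply/highest_atP/highest_atP => -[p [pX pv lm H]].
  have Sp := merges_val ST pX yX pv.
  exists p; split=> //.
    move=> q qX Sq; rewrite leqNgt; apply/negP => qp.
    have := std q p qX pX (ltnW qp); rewrite Sp Sq leqnn pv => Tq.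
    have : T q = S y by apply/eqP; rewrite eqn_leq Tq -{1}Sq val_le.
    by move=> /(lm q qX); rewrite leqNgt qp.
  case: H => [|[q [qX vq qmin pq]]]; [by left|right; exists q; split=> //].
    by rewrite -gt.
  move=> q' q'X; rewrite -gt // -le // => vq'.
  by apply: leq_trans (qmin q' q'X vq') _; apply: val_le.
have Tp : T p = S y.
  have [z zX Tz] := val y yX; have Sz := merges_val ST zX yX Tz.
  apply/eqP; rewrite eqn_leq -{1}pv val_le //.
  by rewrite -Tz std // ?lm // Sz pv leqnn.
exists p; split=> //.
  by move=> q qX Tq; apply: lm => //; apply: merges_val Tq.
case: H => [|[q [qX vq qmin pq]]]; [by left|right].
(* A cell [q'] of least [T]-value above [S y] serves unless it is left of [q]; in that case the
   standardization shows that [q] has the least [T]-value too. *)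
have [|q' [q'X vq' q'min]] := @seq_argmin _ X (fun z => S y < T z) T.
  by apply/hasP; exists q; rewrite ?gt.
case: (leqP q.2 q'.2) => [qq'|/ltnW q'q].
  by exists q'; split=> //; apply: leq_trans qq'.
exists q; split=> //; first by rewrite gt.
move=> z zX vz; apply: leq_trans (q'min z zX vz).
by rewrite std // qmin // -gt.
Qed.

(** No merged interval crosses a value highest in [T]. Otherwise the leftmost cell [z] of value [v]
    changes under merging, so it is not in column one, and a cell [w] weakly right of [z] has the
    next larger value in [T]; then [S w <= S z] although [T z < T w], against the
    standardization. *)
Lemma highest_at_between S T x v : {in X, forall x, 1 <= x.2} -> merges S T ->
  x \in X -> highest_at T v -> T x <= v -> S x <= v.
Proof.
move=> col_gt0 ST xX /highest_atP[z [zX Tz lm H]] xv; rewrite leqNgt; apply/negP => vS.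
have [std le val] := ST; have val_le := merges_le ST.
have Sz : S z = S x.
  apply/eqP; rewrite eqn_leq -le // Tz ltnW //=.
  by rewrite -le // (leq_trans xv) // -Tz val_le.
case: H => [z1|[w [wX vw wmin zw]]].
  by move: (merges_col1 col_gt0 ST zX z1); rewrite Tz Sz; lia.
have := std z w zX wX zw; rewrite Tz Sz leqNgt vw /= => /esym/negbT.
have [w' w'X Tw'] := val x xX.
by rewrite -le // -Tw' wmin // Tw'.
Qed.

(** Where the condition fails, all cells of the next larger value lie strictly left of all cells of
    the failing value. Induction on a bound for [f y - f x] chains these failures from [f x] up to
    [f y]. *)
Lemma not_highest_at_left f x y : x \in X -> y \in X ->
  (forall v, f x <= v -> v < f y -> ~~ highest_at f v) -> f x < f y -> y.2 < x.2.
Proof.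
move: {2}(f y - f x) (leqnn (f y - f x)) => k.
elim: k x => [|k IHk] x; first by lia.
move=> le xX yX ng lt.
have [|p [pX /eqP fp lm]] := @seq_argmin _ X (fun z => f z == f x) (fun z => z.2).
  by apply/hasP; exists x.
have px : p.2 <= x.2 by apply: lm.
have [|q [qX fq qmin]] := @seq_argmin _ X (fun z => f x < f z) f.
  by apply/hasP; exists y.
have qp : q.2 < p.2.
  rewrite ltnNge; apply/negP => pq.
  have /highest_atP[] := ng (f x) (leqnn _) lt.
  exists p; split=> //; first by move=> z zX /eqP; apply: lm.
  by right; exists q; split.
have := qmin y yX lt; rewrite leq_eqVlt => /orP[/eqP qy|qy].
  rewrite ltnNge; apply/negP => xy.
  have /highest_atP[] := ng (f x) (leqnn _) lt.
  exists p; split=> //; first by move=> z zX /eqP; apply: lm.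
  right; exists y; split=> //; first by move=> z; rewrite -qy; apply: qmin.
  exact: leq_trans xy.
suff : y.2 < q.2 by lia.
apply: IHk => // [|v qv]; first by lia.
by apply: ng; lia.
Qed.

(** The least highest value from [v] on, if there is one: a highest value is attained by [f], hence
    lies in the range searched. *)
Definition raise f (v : nat) : nat :=
  v + find (highest_at f) (iota v (\max_(x <- X) f x).+1).

Lemma raiseP f v p : highest_at f p -> v <= p ->
  [/\ highest_at f (raise f v), v <= raise f v &
      forall q, highest_at f q -> v <= q -> raise f v <= q].
Proof.
set s := iota v (\max_(x <- X) f x).+1.
have mem q : highest_at f q -> v <= q -> q \in s.
  move=> /highest_atP[x [xX <- _ _]] vx; rewrite mem_iota vx /=.
  have := @leq_bigmax_seq _ X (fun _ => true) f x xX isT => /=; lia.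
have fP q : highest_at f q -> v <= q -> find (highest_at f) s <= q - v.
  move=> gq vq; rewrite leqNgt; apply/negP => lt.
  have := before_find 0 lt; rewrite nth_iota ?subnKC ?gq //.
  by have := mem q gq vq; rewrite mem_iota; lia.
move=> gp vp; have hs : has (highest_at f) s by apply/hasP; exists p; rewrite ?mem.
split; [|exact: leq_addr|].
  have := nth_find 0 hs; rewrite nth_iota //.
  by move: hs; rewrite has_find size_iota.
by move=> q gq vq; have := fP q gq vq; rewrite /raise -/s; lia.
Qed.

Section Raise.

Variable T : nat * nat -> nat.
Hypothesis below_highest_at : {in X, forall x, exists2 p, highest_at T p & T x <= p}.

Let S x := raise T (T x).

Lemma merges_raise : merges S T.
Proof.
have SP x : x \in X -> [/\ highest_at T (S x), T x <= S x &
    forall q, highest_at T q -> T x <= q -> S x <= q].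
  by move=> xX; have [p gp le] := below_highest_at xX; apply: raiseP gp le.
have mono : {in X &, forall x y, T x <= T y -> S x <= S y}.
  move=> x y xX yX le; have [gy yS _] := SP y yX; have [_ _] := SP x xX.
  by apply=> //; apply: leq_trans yS.
split=> [x y xX yX xy|x y xX yX|y yX].
- apply/idP/idP; first exact: mono.
  move=> Syx; rewrite leqNgt; apply/negP => lt.
  have [gx _ xmin] := SP x xX; have [_ yS _] := SP y yX.
  (* No value from [T x] up to below [T y] is highest, because [S x] is the least highest value from
     [T x] on and [T y <= S y <= S x]. *)
  suff : y.2 < x.2 by rewrite ltnNge xy.
  apply: (@not_highest_at_left T) => // v xv vy.
  by apply/negP => /xmin/(_ xv); lia.
- have [_ xS xmin] := SP x xX; have [gy _ _] := SP y yX.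
  by apply/idP/idP => [/xmin->//|]; apply: leq_trans.
- by have [/highest_atP[x [xX Tx _ _]] _ _] := SP y yX; exists x.
Qed.

End Raise.

(** [S] can be recovered from [T]: [S x] is highest in [T], which bounds [raise] from above, and no
    merged interval crosses the highest value [raise T (T x)], which bounds it from below. *)
Lemma raise_merges S T : {in X, forall x, 1 <= x.2} ->
  merges S T -> {in X, forall x, highest_at S (S x)} ->
  {in X, forall x, raise T (T x) = S x}.
Proof.
move=> col_gt0 ST gS x xX.
have gT : highest_at T (S x) by rewrite (merges_highest_at ST) ?gS.
have [gr le rmin] := raiseP gT (merges_le ST xX).
apply/eqP; rewrite eqn_leq rmin ?(merges_le ST) //=.
exact: highest_at_between gr le.
Qed.

(** * Weights and fixed slides *)

Definition weight n f : seq nat := [seq count (fun x => f x == i) X | i <- iota 1 n].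

Lemma size_weight n f : size (weight n f) = n.
Proof. by rewrite size_map size_iota. Qed.

Lemma nth_weight n f i :
  nth 0 (weight n f) i = if i < n then count (fun x => f x == i.+1) X else 0.
Proof.
case: ltnP => lt; last by rewrite nth_default ?size_weight.
by rewrite (nth_map 0) ?size_iota // nth_iota.
Qed.

Lemma eq_weight n f g : {in X, f =1 g} -> weight n f = weight n g.
Proof.
by move=> fg; apply: eq_map => i; apply: eq_in_count => x xX /=; rewrite fg.
Qed.

Lemma weight_count_eq n f g : {in X, forall x, 1 <= f x <= n} ->
  {in X, forall x, 1 <= g x <= n} -> weight n f = weight n g ->
  forall v, count (fun x => f x <= v) X = count (fun x => g x <= v) X.
Proof.
move=> fn gn fg; elim=> [|v IHv].
  rewrite !(eq_in_count (a2 := pred0)) // => x xX /=.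
    by have := gn x xX; lia.
  by have := fn x xX; lia.
have step h : count (fun x => h x <= v.+1) X =
    count (fun x => h x <= v) X + count (fun x => h x == v.+1) X.
  rewrite -count_predUI -[LHS]addn0; congr (_ + _).
    by apply: eq_count => x /=; lia.
  by rewrite -[LHS](count_pred0 X); apply: eq_count => x /=; lia.
rewrite !step IHv; congr (_ + _).
have := congr1 (nth 0 ^~ v) fg; rewrite /= !nth_weight.
case: ltnP => // nv _; rewrite !(eq_in_count (a2 := pred0)) // => x xX /=.
  by have := gn x xX; lia.
by have := fn x xX; lia.
Qed.

Lemma sumn_weight n f : {in X, forall x, 1 <= f x <= n} ->
  sumn (weight n f) = size X.
Proof.
move=> fn; rewrite /weight sumnE big_map.
under eq_bigr do rewrite -sum1_count.
rewrite (exchange_big_dep xpredT) //= -sum1_size big_seq_cond [RHS]big_seq_cond.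
apply: eq_bigr => x /andP[xX _]; rewrite sum1_count.
have -> : count (fun i => f x == i) (iota 1 n) = count_mem (f x) (iota 1 n).
  by apply: eq_count => i /=; rewrite eq_sym.
by rewrite count_uniq_mem ?iota_uniq // mem_iota add1n ltnS fn.
Qed.

Lemma merges_slide n S T : {in X, forall x, 1 <= T x} ->
  {in X, forall x, S x <= n} -> merges S T ->
  fixed_slide (weight n S) (weight n T).
Proof.
move=> T1 Sn ST; have [_ le val] := ST; have val_le := merges_le ST.
(* On [X], [U k] interpolates between [S] at [k = n] and [T] at [k = 0]: values of [T] above [k] are
   already final, the other cells are still merged but capped at [k]. Lowering [k] by one costs at
   most one local move. *)
pose U k x := if k < T x then T x else minn (S x) k.
suff slide k : k <= n -> fixed_slide (weight n S) (weight n (U (n - k))).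
  have := slide n (leqnn n); rewrite subnn (@eq_weight n (U 0) T) // => x xX.
  by rewrite /U T1.
elim: k => [|k IHk] kn.
  rewrite subn0 (@eq_weight n (U n) S); first exact: fs_refl.
  move=> x xX; rewrite /U; have := Sn x xX; have := val_le x xX.
  by case: ifP; lia.
have {IHk} := IHk (ltnW kn).
have -> : n - k = (n - k.+1).+1 by lia.
have : n - k.+1 < n by lia.
move: (n - k.+1) => {kn} m mn; case: m mn => [|m] mn IH.
  rewrite (@eq_weight n (U 0) (U 1)) // => x xX; rewrite /U T1 //.
  by have := T1 x xX; have := val_le x xX; case: ifP; lia.
(* If [m.+1] is a value of [S], no merged interval extends across it and [U] does not change.
   Otherwise the cells of value [m.+2] are split between [m.+1] and [m.+2]. *)
have [/hasP[y yX /eqP Sy]|no] := boolP (has (fun x => S x == m.+1) X).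
  rewrite (@eq_weight n (U m.+1) (U m.+2)) // => x xX; rewrite /U.
  have := le x y xX yX; rewrite Sy; have := val_le x xX.
  by case: ifP; case: ifP; lia.
have noS x : x \in X -> S x != m.+1.
  by move=> xX; apply: contra no => Sx; apply/hasP; exists x.
apply: fs_step IH _.
exists m.+1, (count (fun x => U m.+1 x == m.+1) X), (count (fun x => U m.+1 x == m.+2) X).
split.
- by rewrite size_weight /=.
- rewrite nth_weight ltnW //; apply/eqP; rewrite -leqn0 leqNgt -has_count.
  apply/negP => /hasP[x xX]; rewrite /U; have := noS x xX.
  by case: ifP; lia.
- rewrite nth_weight mn -count_predUI -[RHS]addn0; congr (_ + _).
    apply: eq_in_count => x xX; rewrite /U /=; have := noS x xX; have := val_le x xX.
    by case: ifP; case: ifP; lia.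
  by rewrite -[RHS](count_pred0 X); apply: eq_count => x /=; lia.
(* If [S] takes the value [m.+2], so does [T], and the cell where it does so stays at [m.+2]. *)
- rewrite nth_weight mn -lt0n -has_count => /hasP[y yX /eqP Sy].
  have [x xX Tx] := val y yX; rewrite -has_count; apply/hasP; exists x => //.
  by rewrite /U Tx Sy leqnn.
apply: (@eq_from_nth _ 0) => [|i].
  by rewrite !size_set_nth !size_weight; lia.
rewrite size_weight => lin; rewrite !nth_set_nth /= !nth_set_nth /= !nth_weight lin.
case: eqP => [->//|i1]; case: eqP => [->//|i2].
apply: eq_in_count => x xX; rewrite /U /=; have := noS x xX; have := val_le x xX.
by case: ifP; case: ifP; lia.
Qed.

(** Each local move is lifted to the cells by lowering the rightmost cells of one value by one,
    which respects the standardization. *)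
Lemma slide_merges n S c : uniq X ->
  {in X, forall x, 1 <= S x} ->
  {in X &, forall x y, x.2 = y.2 -> S x = S y -> x = y} ->
  fixed_slide (weight n S) c ->
  exists T, [/\ merges S T, {in X, forall x, 1 <= T x} & weight n T = c].
Proof.
move=> uX S1 dist; elim=> [|d d' _ [T [ST T1 <-]] [p [i [j [ps dp ij bp ->]]]]].
  by exists S; split=> //; apply: merges_refl.
have {ps} [p1 pn] : 1 <= p /\ p < n by move: ps; rewrite size_weight => /andP[].
(* Positions start at 1, so the move goes from the value [p.+2] to the value [p.+1], which [T] does
   not take. *)
case: p p1 pn dp ij bp => // p _ pn; rewrite !nth_weight /= pn ltnW // => dp ij bp.
have [std le val] := ST.
have noT x : x \in X -> T x != p.+1.
  move=> xX; apply/negP => Tx.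
  have : has (fun x => T x == p.+1) X by apply/hasP; exists x.
  by rewrite has_count dp.
(* Within a column the standardization transfers both inequalities, so equal values of [T] force
   equal values of [S]. *)
have distT : {in X &, forall x y, T x == p.+2 -> T y == p.+2 -> x.2 = y.2 -> x = y}.
  move=> x y xX yX /eqP Tx /eqP Ty xy; apply: dist => //; apply/eqP.
  by rewrite eqn_leq -!std ?xy // Tx Ty leqnn.
have [|t ti] := @column_threshold X (fun x => T x == p.+2) i uX distT.
  by rewrite -ij leq_addr.
have tj : count (fun x => (T x == p.+2) && (x.2 < t)) X = j.
  apply/eqP; rewrite -(eqn_add2l i) -{1}ti ij -count_predUI -[X in _ == X]addn0.
  apply/eqP; congr (_ + _); first by apply: eq_count => x /=; lia.
  by rewrite -[RHS](count_pred0 X); apply: eq_count => x /=; lia.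
(* Exactly the [i] rightmost cells of value [p.+2] are lowered. *)
pose T' x := if (T x == p.+2) && (t <= x.2) then p.+1 else T x.
exists T'; split.
- split=> [x y xX yX xy|x y xX yX|y yX].
  + rewrite -std // /T'; have := noT x xX; have := noT y yX.
    by case: ifP; case: ifP; lia.
  + rewrite -le // /T'; have [z zX Tz] := val y yX.
    by have := noT z zX; case: ifP; lia.
  (* If [p.+2] is a value of [S], it must remain a value of [T']; this is what [0 < j]
     guarantees. *)
  + have [Sy|Sy] := eqVneq (S y) p.+2.
      have : 0 < count (fun x => (T x == p.+2) && (x.2 < t)) X.
        rewrite tj; apply: bp; rewrite -lt0n -has_count; apply/hasP.
        by exists y; rewrite ?Sy.
      rewrite -has_count => /hasP[x xX /andP[/eqP Tx xt]]; exists x => //.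
      by rewrite /T' leqNgt xt andbF Tx Sy.
    have [x xX Tx] := val y yX; exists x => //.
    by rewrite /T' Tx (negPf Sy).
- by move=> x xX; rewrite /T'; case: ifP => // _; apply: T1.
apply: (@eq_from_nth _ 0) => [|k].
  by rewrite !size_set_nth !size_weight; lia.
rewrite size_weight => kn; rewrite !nth_set_nth /= !nth_set_nth /= !nth_weight kn.
case: eqP => [->|k1]; first by rewrite -tj;
  apply: eq_count => x; rewrite /T'; case: ifP; lia.
case: eqP => [->|k2].
  rewrite -ti; apply: eq_in_count => x xX; rewrite /T' /=.
  by have := noT x xX; case: ifP; lia.
by apply: eq_count => x; rewrite /T' /=; case: ifP; lia.
Qed.

End Merging.

(** * Fillings as functions on the cells of the diagram *)

Definition cell (S : seq (seq nat)) (x : nat * nat) : nat := ent S x.1 x.2.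

Definition fill (a : seq nat) (f : nat * nat -> nat) : seq (seq nat) :=
  [seq [seq f (r, c) | c <- iota 1 (arow a r)] | r <- iota 1 (size a)].

Lemma mem_cells a x : (x \in cells a) = in_diag a x.1 x.2.
Proof.
rewrite /in_diag; apply/allpairsPdep/idP => [[r [c []]]|].
  by rewrite !mem_iota => rP cP -> /=; lia.
case: x => r c /= H; exists r, c; rewrite !mem_iota.
by move: (arow a r) H => m H; split=> //; lia.
Qed.

Lemma cells_uniq a : uniq (cells a).
Proof.
apply: allpairs_uniq_dep => [|r _|]; rewrite ?iota_uniq //.
by move=> [r c] [r' c'] _ _ /= [-> ->].
Qed.

Lemma cells_col a : {in cells a, forall x, 1 <= x.2}.
Proof. by move=> x; rewrite mem_cells => /and4P[]. Qed.

Lemma cell_fill a f : {in cells a, cell (fill a f) =1 f}.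
Proof.
move=> [r c]; rewrite mem_cells /cell /ent /fill => /and4P[/= r1 ra c1 ca].
rewrite (nth_map 0) ?size_iota; last by lia.
rewrite nth_iota ?add1n ?prednK //.
by rewrite (nth_map 0) ?size_iota ?nth_iota ?add1n ?prednK //; lia.
Qed.

Lemma shape_fill a f : map size (fill a f) = a.
Proof.
apply: (@eq_from_nth _ 0) => [|i]; rewrite !size_map size_iota // => ia.
rewrite -map_comp (nth_map 0) ?size_iota //= size_map size_iota nth_iota //.
Qed.

Lemma fill_cell a S : map size S = a -> fill a (cell S) = S.
Proof.
move=> <-; apply: (@eq_from_nth _ [::]) => [|i]; rewrite !size_map size_iota ?size_map //.
move=> iS; rewrite (nth_map 0) ?size_iota ?size_map // nth_iota //.
rewrite add1n /arow /= (nth_map [::]) //.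
apply: (@eq_from_nth _ 0) => [|j]; rewrite size_map size_iota // => jS.
by rewrite (nth_map 0) ?size_iota // nth_iota.
Qed.

Lemma eq_fill a f g : {in cells a, f =1 g} -> fill a f = fill a g.
Proof.
move=> fg; apply/eq_in_map => r; rewrite mem_iota => rP.
apply/eq_in_map => c; rewrite mem_iota => cP; apply: fg.
by rewrite mem_cells /in_diag /=; lia.
Qed.

Lemma wt_weight n a S : map size S = a -> wt n S = weight (cells a) n (cell S).
Proof.
move=> Sa; rewrite -{1}(fill_cell Sa); apply: eq_map => i.
have -> : flatten (fill a (cell S)) = map (cell S) (cells a).
  by rewrite /fill /cells map_flatten -map_comp; congr flatten;
    apply: eq_map => r /=; rewrite -map_comp.
by rewrite count_map; apply: eq_count.
Qed.

(** * Transport of the defining conditions along equal standardizations *)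

Section Transport.

Variables (a : seq nat) (S T : seq (seq nat)).
Hypothesis Sa : map size S = a.
Hypothesis S_gt0 : {in cells a, forall x, 1 <= cell S x}.
Hypothesis std : same_std (cells a) (cell T) (cell S).
Hypothesis col1 : {in cells a, forall x, x.2 = 1 -> cell T x = cell S x}.

Lemma same_std_assf : assf a T -> assf a S.
Proof.
have le r c r' c' : in_diag a r c -> in_diag a r' c' -> c <= c' ->
    (ent T r' c' <= ent T r c) = (ent S r' c' <= ent S r c).
  by move=> rc rc' cc; apply: (std (x := (r, c)) (y := (r', c'))); rewrite ?mem_cells.
have lt r c r' c' : in_diag a r c -> in_diag a r' c' -> c <= c' ->
    (ent T r c < ent T r' c') = (ent S r c < ent S r' c').
  by move=> rc rc' cc; rewrite !ltnNge le.
(* In both types of triple, gamma is weakly left of beta and beta weakly left of alpha, so every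
   comparison in [inv_triple] is decided by the standardization. *)
have inv b bc g gc al alc : in_diag a b bc -> in_diag a g gc -> in_diag a al alc ->
    gc <= bc -> gc <= alc -> bc <= alc ->
    inv_triple (ent T b bc) (ent T g gc) (ent T al alc) =
    inv_triple (ent S b bc) (ent S g gc) (ent S al alc).
  by move=> bD gD alD gb ga ba; rewrite /inv_triple !le // !lt.
case/and5P=> _ _ row dist /and3P[tA tB fst].
apply/and5P; split; first by rewrite Sa.
- by apply/allP => x xX; apply: S_gt0.
- apply/allP => -[r c] xX; have := allP row _ xX => /=.
  case: leqP => // ca /=; move: xX; rewrite mem_cells => xX.
  by rewrite le ?leqnSn //; move: xX; rewrite /in_diag /=; lia.
- apply/allP => -[r c] xX; apply/allP => -[r' c'] yX.
  have := allP (allP dist _ xX) _ yX => /=.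
  case: eqP => [cc|]; rewrite ?andbF // andbT; case: ltnP => //= rr'; subst c'.
  (* Two cells of one column are comparable in both directions, so equality of entries is
     transported as well. *)
  by move: xX yX; rewrite !mem_cells => xX yX; rewrite !eqn_leq !le.
apply/and3P; split.
- apply/allP => -[r c] xX; apply/allP => s sP.
  have := allP (allP tA _ xX) _ sP => /=; case: and4P => // -[_ _ rc sc] /=.
  by rewrite inv //; move: xX; rewrite mem_cells.
- apply/allP => -[s c] xX; apply/allP => r rP.
  have := allP (allP tB _ xX) _ rP => /=; case: and4P => // -[_ _ sc rc] /=.
  by rewrite inv //; move: xX; rewrite mem_cells.
- apply/allP => i iP; have := allP fst _ iP; case: ltnP => //= ai.
  have xX : (i, 1) \in cells a by move: iP; rewrite mem_cells mem_iota /in_diag /=; lia.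
  by have := col1 xX erefl; rewrite /cell /= => ->.
Qed.

End Transport.

(** * Basic properties of the fillings in A-SSF *)

Section Assf.

Variables (a : seq nat) (S : seq (seq nat)).
Hypothesis aS : assf a S.

Lemma assf_shape : map size S = a.
Proof. by apply/eqP; case/andP: aS. Qed.

Lemma assf_gt0 : {in cells a, forall x, 1 <= cell S x}.
Proof. by case/and3P: aS => _ /allP. Qed.

Lemma assf_col1 : {in cells a, forall x, x.2 = 1 -> cell S x = x.1}.
Proof.
move: aS => /and5P[_ _ _ _ /and3P[_ _ /allP fst]] [r c] xX /= c1; subst c.
move: xX; rewrite mem_cells => /and4P[/= r1 ra _ r0].
by apply/eqP; apply: (implyP (fst r _)) => //; rewrite mem_iota; lia.
Qed.

Lemma assf_row : {in cells a, forall x, cell S x <= cell S (x.1, 1)}.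
Proof.
move: aS => /and5P[_ _ /allP row _ _] [r c]; elim: c => [|c IHc].
  by rewrite mem_cells /in_diag /= andbF.
case: c IHc => // c IHc; rewrite mem_cells => /and4P[/= r1 ra _ cr].
have xX : (r, c.+1) \in cells a by rewrite mem_cells /in_diag /=; lia.
by apply: leq_trans (IHc xX); apply: (implyP (row _ xX)).
Qed.

Lemma assf_le : {in cells a, forall x, cell S x <= size a}.
Proof.
move=> [r c] xX; apply: leq_trans (assf_row xX) _ => /=.
move: xX; rewrite mem_cells => /and4P[/= r1 ra c1 cr].
rewrite (@assf_col1 (r, 1)) //.
by rewrite mem_cells /in_diag /=; lia.
Qed.

Lemma assf_dist :
  {in cells a &, forall x y, x.2 = y.2 -> cell S x = cell S y -> x = y}.
Proof.
move: aS => /and5P[_ _ _ /allP dist _] [r c] [r' c'] xX yX /= cc'; subst c' => E.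
have := allP (dist _ xX) _ yX; have := allP (dist _ yX) _ xX.
rewrite /= -!/(cell S (_, _)) E eqxx andbT.
by case: (ltngtP r r') => [_ _|//|->]; rewrite ?eqxx.
Qed.

(** The first entry of each row is highest because it occurs in column one, and it bounds its row.
    Hence [raise] finds a highest value from every entry. *)
Lemma assf_below_highest_at :
  {in cells a, forall x, exists2 p, highest_at (cells a) (cell S) p & cell S x <= p}.
Proof.
move=> [r c] xX; exists (cell S (r, 1)); last exact: assf_row.
apply/highest_atP; exists (r, 1).
have yX : (r, 1) \in cells a by move: xX; rewrite !mem_cells /in_diag /=; lia.
by split=> //; [move=> q qX _; apply: (cells_col qX)|left].
Qed.

End Assf.

(** * Enumerations of fillings and of weak compositions *)

Lemma mem_words k m w : (w \in words k m) = (size w == k) && all (mem (iota 1 m)) w.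
Proof.
elim: k w => [|k IHk] [|x w] //=.
  by apply/allpairsP => -[[y v] [_ _]].
rewrite eqSS andbCA -IHk; apply/allpairsP/andP => [[[y v] /= [yP vP [-> ->]]]|[xP wP]] //.
by exists (x, w).
Qed.

Lemma words_uniq k m : uniq (words k m).
Proof.
elim: k => //= k IHk; apply: allpairs_uniq; rewrite ?iota_uniq //.
by move=> [x v] [y w] _ _ /= [-> ->].
Qed.

Lemma mem_fillings a m S : (S \in fillings a m) =
  (map size S == a) && all (all (mem (iota 1 m))) S.
Proof.
elim: a S => [|k a IHa] [|w S] //=.
  by apply/allpairsP => -[[y v] [_ _]].
rewrite eqseq_cons andbACA -IHa -mem_words.
apply/allpairsP/andP => [[[y v] /= [yP vP [-> ->]]]|[xP wP]] //.
by exists (w, S).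
Qed.

Lemma fillings_uniq a m : uniq (fillings a m).
Proof.
elim: a => //= k a IHa; apply: allpairs_uniq; rewrite ?words_uniq //.
by move=> [x v] [y w] _ _ /= [-> ->].
Qed.

Lemma assf_fillings a S : assf a S -> S \in fillings a (size a).
Proof.
move=> aS; rewrite mem_fillings (assf_shape aS) eqxx /=.
rewrite -(fill_cell (assf_shape aS)); apply/allP => w /mapP[r rP ->].
apply/allP => v /mapP[c cP ->].
have xX : (r, c) \in cells a.
  by move: rP cP; rewrite mem_cells !mem_iota /in_diag /=; move: (arow a r); lia.
by rewrite /= mem_iota (assf_gt0 aS) // add1n ltnS (assf_le aS).
Qed.

Lemma mem_wcomps n s c : (c \in wcomps n s) = (size c == n) && (sumn c == s).
Proof.
elim: n s c => [|n IHn] s c.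
  by case: s => [|s]; case: c => [|x c] //=; rewrite inE.
have -> : wcomps n.+1 s = [seq k :: w | k <- iota 0 s.+1, w <- wcomps n (s - k)] by [].
apply/allpairsPdep/idP => [[k [w [kP wP ->]]]|].
  move: kP wP; rewrite mem_iota IHn /= eqSS => kP /andP[/eqP<- /eqP w_sum].
  by rewrite eqxx /=; lia.
case: c => // x c /=; rewrite eqSS => /andP[sc /eqP xs].
exists x, c; split=> //; first by rewrite inE mem_iota; lia.
by rewrite IHn sc; lia.
Qed.

Lemma wcomps_uniq n s : uniq (wcomps n s).
Proof.
elim: n s => [|n IHn] [|s] //; apply: allpairs_uniq_dep; rewrite ?iota_uniq //.
all: by move=> [x v] [y w] _ _ /= [-> ->].
Qed.

Lemma pdecP P : reflect P (pdec P).
Proof.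
by rewrite /pdec; case: ClassicalEpsilon.excluded_middle_informative; constructor.
Qed.

(** * The map to particle-highest fillings and its fibres *)

Definition highest (a : seq nat) (T : seq (seq nat)) : seq (seq nat) :=
  fill a (fun x => raise (cells a) (cell T) (cell T x)).

Lemma particle_highestE a S : particle_highest a S =
  all (fun x => highest_at (cells a) (cell S) (cell S x)) (cells a).
Proof. by []. Qed.

Lemma eq_in_same_std X f f' g g' : {in X, f =1 f'} -> {in X, g =1 g'} ->
  same_std X f g -> same_std X f' g'.
Proof. by move=> ff gg fg x y xX yX xy; rewrite -!ff // -!gg // fg. Qed.

Lemma eq_in_merges X S S' T T' : {in X, S =1 S'} -> {in X, T =1 T'} ->
  merges X S T -> merges X S' T'.
Proof.
move=> SS TT [std le val]; split; first exact: eq_in_same_std std.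
  by move=> x y xX yX; rewrite -!SS // -TT // le.
by move=> y yX; have [x xX Tx] := val y yX; exists x; rewrite // -SS // -TT.
Qed.

Lemma highest_merges a T : assf a T -> merges (cells a) (cell (highest a T)) (cell T).
Proof.
move=> aT; apply: eq_in_merges (merges_raise (assf_below_highest_at aT)) => //.
by move=> x xX; rewrite cell_fill.
Qed.

(** Merging preserves the standardization and the first column, so A-SSF is preserved. The new
    values are highest for [T], hence for the merged filling by [merges_highest_at]. *)
Lemma hssf_highest a T : assf a T -> hssf a (highest a T).
Proof.
move=> aT; have ST := highest_merges aT; have [std _ _] := ST.
have eqS : {in cells a, cell (highest a T) =1
    fun x => raise (cells a) (cell T) (cell T x)}.
  exact: cell_fill.
apply/andP; split.
  apply: (same_std_assf _ _ std _ aT); first exact: shape_fill.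
    by move=> x xX; apply: leq_trans (merges_le ST xX); apply: (assf_gt0 aT).
  exact: merges_col1 (@cells_col a) ST.
rewrite particle_highestE; apply/allP => x xX.
rewrite -(merges_highest_at ST) // eqS //.
by have [p gp le] := assf_below_highest_at aT xX; case: (raiseP gp le).
Qed.

Lemma merges_highest a S T : hssf a S -> map size T = a ->
  merges (cells a) (cell S) (cell T) -> highest a T = S.
Proof.
move=> /andP[aS pS] Ta ST; rewrite -[RHS](fill_cell (assf_shape aS)).
apply: eq_fill; apply: raise_merges ST _; first exact: cells_col.
by apply/allP; rewrite -particle_highestE.
Qed.

(** Both fillings share the standardization of their common image, and a standardization together
    with a weight determines the filling. *)
Lemma highest_wt_inj a T T' : assf a T -> assf a T' ->
  highest a T = highest a T' -> wt (size a) T = wt (size a) T' -> T = T'.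
Proof.
move=> aT aT' hT; have Ta := assf_shape aT; have Ta' := assf_shape aT'.
rewrite (wt_weight _ Ta) (wt_weight _ Ta') => wT.
have [std _ _] := highest_merges aT; have [std' _ _] := highest_merges aT'.
rewrite -(fill_cell Ta) -(fill_cell Ta'); apply: eq_fill.
apply: same_std_count_eq.
  by apply: same_std_trans std _; rewrite hT; apply: same_std_sym.
apply: weight_count_eq wT => x xX.
  by rewrite (assf_gt0 aT) ?(assf_le aT).
by rewrite (assf_gt0 aT') ?(assf_le aT').
Qed.

(** The weight is a bijection from the fibre of [highest a] over [S] onto the fixed slides of the
    weight of [S]. *)
Lemma Lpoly_hssf a S : hssf a S ->
  Lpoly (size a) (wt (size a) S) =
  (\sum_(T <- fillings a (size a) | assf a T && (S == highest a T))
     'X_[mono (size a) (wt (size a) T)])%R.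
Proof.
move=> hS; have /andP[aS pS] := hS; have Sa := assf_shape aS.
rewrite /Lpoly -big_filter -[RHS]big_filter.
rewrite -[RHS](big_map (wt (size a)) xpredT (fun c => 'X_[mono (size a) c]))%R.
apply: perm_big; apply: uniq_perm.
- by rewrite filter_uniq ?wcomps_uniq.
- rewrite map_inj_in_uniq ?filter_uniq ?fillings_uniq // => T T'.
  rewrite !mem_filter => /andP[/andP[aT /eqP hT] _] /andP[/andP[aT' /eqP hT'] _].
  by apply: highest_wt_inj; rewrite -?hT -?hT'.
have fnT T : assf a T -> {in cells a, forall x, 1 <= cell T x <= size a}.
  by move=> aT x xX; rewrite (assf_gt0 aT) ?(assf_le aT).
move=> c; rewrite mem_filter mem_wcomps (wt_weight _ Sa); apply/andP/mapP.
  move=> [/pdecP /slide_merges] []; rewrite ?cells_uniq //.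
  - exact: (assf_gt0 aS).
  - exact: (assf_dist aS).
  (* The function [f] realizes the slide; it fills the diagram, lies in A-SSF by transport from [S],
     and lies over [S] by [merges_highest]. *)
  move=> f [Sf f1 <-] _; exists (fill a f).
    have ST : merges (cells a) (cell S) (cell (fill a f)).
      by apply: eq_in_merges Sf => // x xX; rewrite cell_fill.
    have [std _ _] := ST.
    have aT : assf a (fill a f).
      apply: (same_std_assf _ _ _ _ aS); first exact: shape_fill.
      + by move=> x xX; rewrite cell_fill ?f1.
      + exact: same_std_sym.
      + by move=> x xX x1; rewrite (merges_col1 (@cells_col a) ST).
    by rewrite mem_filter aT assf_fillings ?(merges_highest hS) ?shape_fill ?eqxx.
  by rewrite (wt_weight _ (shape_fill a f)); apply: eq_weight => x xX; rewrite cell_fill.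
move=> [T]; rewrite mem_filter => /andP[/andP[aT /eqP hT] _] ->.
(* Both weights have length [size a] and sum to the number of cells. *)
rewrite (wt_weight _ (assf_shape aT)) size_weight !sumn_weight ?eqxx; try exact: fnT.
split=> //; apply/pdecP; apply: merges_slide.
- exact: (assf_gt0 aT).
- exact: (assf_le aS).
- by rewrite hT; apply: highest_merges.
Qed.

Theorem theorem4p17 (n : nat) (a : seq nat) :
  size a = n ->
  Apoly n a = (\sum_(F <- fillings a n | hssf a F) Lpoly n (wt n F))%R.
Proof.
move=> <-; rewrite /Apoly (eq_bigr _ (@Lpoly_hssf a)).
(* With the sums exchanged, each [T] is counted once, in the fibre over [highest a T]. *)
rewrite (exchange_big_dep (assf a)) /= => [|S T _ /andP[] //].
apply: eq_bigr => T aT; have hT := hssf_highest aT.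
rewrite -big_filter (eq_filter (a2 := pred1 (highest a T))).
  by rewrite filter_pred1_uniq ?fillings_uniq ?assf_fillings ?big_seq1 //; case/andP: hT.
by move=> S /=; rewrite aT /=; case: eqP => [->|]; rewrite ?andbF ?hT.
Qed.
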